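(* Let $k$ be a subfield of $\mathbf{C}$, let $A$ be a locally finite graded set with an operation $[\cdot,\cdot]$ on $\bar A=A\cup\{0\}$ satisfying (S0)–(S3), and let $*$ be the associated quasi-shuffle multiplication on $\mathfrak{A}=k\langle A\rangle$. Then $(\mathfrak{A},* )$ is a commutative graded $k$-algebra (in particular $*$ is associative).
   Context: $A$ is a graded set, $A=\bigsqcup_{n\ge1}A_n$ with each $A_n$ (the elements of degree $n$) finite; elements of $A$ are called letters and $|a|$ is the degree of a letter $a$. $\mathfrak{A}=k\langle A\rangle$ is the $k$-vector space of noncommutative polynomials in the letters, with basis the words (monomials) in the letters, including the empty word $1$. Juxtaposition denotes concatenation. The degree $|w|$ of a word $w$ is the sum of the degrees of its letters, and $\mathfrak{A}$ is graded by this degree. Let $\bar A=A\cup\{0\}$ and let $[\cdot,\cdot]:\bar A\times\bar A\to\bar A$ be a function satisfying: (S0) $[a,0]=0$ for all $a\in\bar A$; (S1) $[a,b]=[b,a]$ for all $a,b\in\bar A$; (S2) $[[a,b],c]=[a,[b,c]]$ for all $a,b,c\in\bar A$; (S3) for all $a,b\in A$, either $[a,b]=0$ or $|[a,b]|=|a|+|b|$. The quasi-shuffle multiplication $*$ is the $k$-bilinear operation on $\mathfrak{A}$ defined recursively on words by $1*w=w*1=w$ for every word $w$, and $aw_1*bw_2=a(w_1*bw_2)+b(aw_1*w_2)+[a,b](w_1*w_2)$ for all letters $a,b$ and words $w_1,w_2$ (the last term being $0$ if $[a,b]=0$). *)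

(* Defs.v *)
From HB Require Import structures.
From mathcomp Require Import ssreflect ssrfun ssrbool eqtype ssrnat seq choice.
From mathcomp Require Import bigop ssralg sesquilinear finmap.
From mathcomp Require Import classical_sets cardinality reals complex.
From mathcomp Require Import monalg.

Set Implicit Arguments.
Unset Strict Implicit.
Unset Printing Implicit Defensive.

Import GRing.Theory.
Local Open Scope ring_scope.

Definition locally_finite_grading (A : choiceType) (deg : A -> nat) : Prop :=
  (forall a, (0 < deg a)%N) /\
  (forall n : nat, finite_set [set a | deg a = n]%classic).

(* The set A u {0} is [option A], with [None] as the element 0. *)
Record bracket_axioms (A : choiceType) (deg : A -> nat)
    (br : option A -> option A -> option A) : Prop := BracketAxioms {
  br_S0 : forall x, br x None = None;
  br_S1 : forall x y, br x y = br y x;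
  br_S2 : forall x y z, br (br x y) z = br x (br y z);
  br_S3 : forall a b : A, br (Some a) (Some b) = None \/
    exists2 c : A, br (Some a) (Some b) = Some c & deg c = (deg a + deg b)%N
}.

(* The ring product of this type is concatenation, extended bilinearly. *)
Notation ncpoly k A := {malg k[{fmonom A}]}.

Section QuasiShuffle.
Variables (k : fieldType) (A : choiceType).
Variables (deg : A -> nat) (br : option A -> option A -> option A).

Definition word (w : seq A) : ncpoly k A := << FMonom w >>.

Definition letter0 (x : option A) : ncpoly k A :=
  if x is Some a then word [:: a] else 0.

Fixpoint qsh_word (w1 : seq A) : seq A -> ncpoly k A :=
  match w1 with
  | [::] => word
  | a :: w1' =>
    fix qsh_word_a (w2 : seq A) : ncpoly k A :=
      match w2 with
      | [::] => word w1
      | b :: w2' => word [:: a] * qsh_word w1' w2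
                    + word [:: b] * qsh_word_a w2'
                    + letter0 (br (Some a) (Some b)) * qsh_word w1' w2'
      end
  end.

Definition qsh (f g : ncpoly k A) : ncpoly k A :=
  \sum_(u <- msupp f) \sum_(v <- msupp g) (f@_u * g@_v) *: qsh_word u v.

Definition word_deg (w : seq A) : nat := (\sum_(a <- w) deg a)%N.

Definition ncpoly_homog (n : nat) : {pred ncpoly k A} :=
  [pred f : ncpoly k A | all (fun w : {fmonom A} => word_deg w == n) (msupp f)].

End QuasiShuffle.

(* [grading_sum] says that V is the internal direct sum of the V_n. *)
Record comm_graded_algebra (k : fieldType) (V : lmodType k)
    (mul : V -> V -> V) (one : V) (Vn : nat -> {pred V}) : Prop :=
    CommGradedAlgebra {
  cga_bilinear : bilinear_for *:%R *:%R mul;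
  cga_assoc : associative mul;
  cga_comm : commutative mul;
  cga_unit : left_id one mul /\ right_id one mul;
  grading_submod : forall n, GRing.submod_closed (Vn n);
  grading_sum : forall v : V, exists! c : {fsfun nat -> V with 0},
    (forall n, c n \in Vn n) /\ v = \sum_(n <- finsupp c) c n;
  grading_one : one \in Vn 0%N;
  grading_mul : forall m n u v,
    u \in Vn m -> v \in Vn n -> mul u v \in Vn (m + n)%N
}.

(* Main.v *)
(** Write [L x f] for the concatenation [x f] with a letter or zero [x].  By
bilinearity, and since the bracket is absorbing at [0], the recursion reads
[L x f * L y g = L x (f * L y g) + L y (L x f * g) + L [x,y] (f * g)]
for all [x], [y] in [A u {0}] and all polynomials [f], [g].  Applying it twice
to [(L x f * L y g) * L z h] and to [L x f * (L y g * L z h)] gives the same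
terms up to shorter instances of associativity, with [[x,y],z] = [x,[y,z]]. *)
Require Import Defs.
From HB Require Import structures.
From mathcomp Require Import ssreflect ssrfun ssrbool eqtype ssrnat seq choice.
From mathcomp Require Import bigop ssralg sesquilinear finmap.
From mathcomp Require Import classical_sets cardinality reals complex.
From mathcomp Require Import monalg.
From mathcomp Require Import ssrAC.

Set Implicit Arguments.
Unset Strict Implicit.
Unset Printing Implicit Defensive.

Import GRing.Theory.
Local Open Scope ring_scope.

(** * Linear extension of functions on monomials *)

Lemma malgUZ (k : fieldType) (K : choiceType) (c : k) (m : K) :
  << c *g m >> = c *: << m >> :> {malg k[K]}.
Proof. by apply/malgP => w; rewrite mcoeffZ !mcoeffU mulr_natr. Qed.

Section LinearExtension.
Variables (k : fieldType) (K : choiceType) (V : lmodType k) (h : K -> V).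

Definition lext (f : {malg k[K]}) : V := \sum_(u <- msupp f) f@_u *: h u.

(** Coefficients vanish off the support. Linearity needs this freedom, to sum two polynomials and
    their combination over one index set. *)
Lemma lextEw (d : {fset K}) (f : {malg k[K]}) :
  (msupp f `<=` d)%fset -> lext f = \sum_(u <- d) f@_u *: h u.
Proof.
move=> le; rewrite /lext (big_fset_incl _ le) //= => u _ /mcoeff_outdom ->.
by rewrite scale0r.
Qed.

Lemma lext_linear : linear lext.
Proof.
move=> c f g; pose d := (msupp f `|` msupp g)%fset.
have df : (msupp f `<=` d)%fset by apply: fsubsetUl.
have dg : (msupp g `<=` d)%fset by apply: fsubsetUr.
have dcfg : (msupp (c *: f + g) `<=` d)%fset.
  apply: fsubset_trans (msuppD_le _ _) _.
  by rewrite fsubUset dg andbT (fsubset_trans (msuppZ_le _ _)).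
rewrite (lextEw df) (lextEw dg) (lextEw dcfg) scaler_sumr -big_split /=.
by apply: eq_bigr => u _; rewrite mcoeffD mcoeffZ scalerDl scalerA.
Qed.

Lemma lextU (u : K) : lext << u >> = h u.
Proof. by rewrite (lextEw msuppU_le) big_seq_fset1 mcoeffUU scale1r. Qed.

End LinearExtension.

(** * Words as a basis, and concatenation on them *)

Section Words.
Variables (k : fieldType) (A : choiceType).
Implicit Types (f g : ncpoly k A) (u v w : seq A).

(** Reduces identities that are linear in each argument to words. *)
Lemma ncpoly_ind (P : ncpoly k A -> Prop) :
  P 0 -> (forall c w f, P f -> P (c *: word k w + f)) -> forall f, P f.
Proof.
move=> P0 PD f; rewrite [f]monalgE.
elim: (finmap.enum_fset _) => [|m s IHs]; first by rewrite big_nil.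
rewrite big_cons malgUZ -[m]fmK; exact: PD.
Qed.

(** In this form, left concatenation inherits linearity and its values on words from [lext]. *)
Lemma word_mulE u f :
  word k u * f = lext (fun v : {fmonom A} => word k (u ++ v)) f.
Proof.
rewrite malgM_def /word fgmulUg; apply: eq_bigr => v _.
rewrite mul1r malgUZ; congr (_ *: << _ >>).
by apply/eqP; rewrite fmP fmM.
Qed.

Lemma word_mul_linear u : linear (fun f => word k u * f).
Proof. by move=> c f g; rewrite !word_mulE lext_linear. Qed.

Lemma word_mul u v : word k u * word k v = word k (u ++ v).
Proof. by rewrite word_mulE lextU. Qed.

End Words.

(** * Associativity and commutativity of any bilinear product obeying the recursion on words *)

Section QuasiShuffleRecursion.
Variables (k : fieldType) (V : lmodType k) (A : Type).
Variables (br : option A -> option A -> option A).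
(* [W u] is the word [u] and [L x] is concatenation by [x] on the left. *)
Variables (W : seq A -> V) (L : option A -> V -> V) (mul : V -> V -> V).

Local Notation "f ** g" := (mul f g) (at level 40, left associativity).

Hypothesis brx0 : forall x, br x None = None.
Hypothesis brC : commutative br.
Hypothesis brA : forall x y z, br (br x y) z = br x (br y z).
Hypothesis W_ind : forall P : V -> Prop,
  P 0 -> (forall c w f, P f -> P (c *: W w + f)) -> forall f, P f.
Hypothesis L_linear : forall x, linear (L x).
Hypothesis L_None : forall f, L None f = 0.
Hypothesis L_Some : forall a w, L (Some a) (W w) = W (a :: w).
Hypothesis mul_linearl : forall g, linear (fun f => f ** g).
Hypothesis mul_linearr : forall f, linear (mul f).
Hypothesis mul_W1l : forall w, W [::] ** W w = W w.
Hypothesis mul_W1r : forall w, W w ** W [::] = W w.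
Hypothesis mul_Wcons : forall a u b v,
  W (a :: u) ** W (b :: v) = L (Some a) (W u ** W (b :: v))
    + L (Some b) (W (a :: u) ** W v) + L (br (Some a) (Some b)) (W u ** W v).

Let linear0P (F : V -> V) : linear F -> F 0 = 0.
Proof. by move=> /(_ (-1) 0 0); rewrite scaler0 addr0 scaleN1r addNr. Qed.

Let linearDP (F : V -> V) : linear F -> {morph F : f g / f + g}.
Proof. by move=> lF f g; have := lF 1 f g; rewrite !scale1r. Qed.

Let L0 x : L x 0 = 0. Proof. exact: linear0P. Qed.
Let mul0l g : 0 ** g = 0. Proof. exact: (linear0P (mul_linearl g)). Qed.
Let mul0r f : f ** 0 = 0. Proof. exact: linear0P. Qed.
Let LD x f g : L x (f + g) = L x f + L x g. Proof. exact: linearDP. Qed.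

Let mulDl f f' g : (f + f') ** g = f ** g + f' ** g.
Proof. exact: (linearDP (mul_linearl g)). Qed.

Let mulDr f g g' : f ** (g + g') = f ** g + f ** g'.
Proof. exact: linearDP. Qed.

Lemma qsrec1l f : W [::] ** f = f.
Proof.
elim/W_ind: f => [|c w f IH]; first exact: mul0r.
by rewrite mul_linearr mul_W1l IH.
Qed.

Lemma qsrec1r f : f ** W [::] = f.
Proof.
elim/W_ind: f => [|c w f IH]; first exact: mul0l.
by rewrite mul_linearl mul_W1r IH.
Qed.

(** Both sides are linear in [f] and in [g], so the recursion passes from words to polynomials. This
    generality is needed because the tails met below are themselves products. *)
Let mul_letters a b f g :
  L (Some a) f ** L (Some b) g =
  L (Some a) (f ** L (Some b) g) + L (Some b) (L (Some a) f ** g)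
  + L (br (Some a) (Some b)) (f ** g).
Proof.
elim/W_ind: f => [|c u f IHf]; first by rewrite !(L0, mul0l) !addr0.
rewrite !(L_linear, mul_linearl) IHf.
suff -> : L (Some a) (W u) ** L (Some b) g =
    L (Some a) (W u ** L (Some b) g) + L (Some b) (L (Some a) (W u) ** g)
    + L (br (Some a) (Some b)) (W u ** g).
  by rewrite !scalerDr (AC (3*3) ((1*4)*(2*5)*(3*6))).
elim/W_ind: g {f IHf} => [|d v g IHg]; first by rewrite !(L0, mul0r) !addr0.
rewrite !(L_linear, mul_linearr) IHg !L_Some mul_Wcons.
by rewrite !scalerDr (AC (3*3) ((1*4)*(2*5)*(3*6))).
Qed.

(** A bracket created by one use of the recursion may be 0, so a second use must allow 0 as a
    leading letter; the terms headed by 0 then vanish. *)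
Let mul_letters0 x y f g :
  L x f ** L y g = L x (f ** L y g) + L y (L x f ** g) + L (br x y) (f ** g).
Proof.
case: x y => [a|] [b|]; first exact: mul_letters.
- by rewrite brx0 !L_None !mul0r L0 !addr0.
- by rewrite brC brx0 !L_None !mul0l L0 !addr0.
- by rewrite brx0 !L_None mul0l !addr0.
Qed.

(** The seven terms correspond to the nonempty subsets of [x], [y], [z]: the chosen letters merge
    into the leading one and leave their factors. *)
Let mul_letters3r x y z f g h :
  L x f ** (L y g ** L z h) =
    L x (f ** (L y g ** L z h)) + L y (L x f ** (g ** L z h))
    + L z (L x f ** (L y g ** h)) + L (br x y) (f ** (g ** L z h))
    + L (br x z) (f ** (L y g ** h)) + L (br y z) (L x f ** (g ** h))
    + L (br x (br y z)) (f ** (g ** h)).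
Proof.
(* The term headed by [x] is expanded on the right as well, since the left side yields it in three
   pieces (1, 4 and 7 of the nine). *)
rewrite [in LHS](mul_letters0 y z) [in X in _ = X + _ + _ + _ + _ + _ + _](mul_letters0 y z).
rewrite !mulDr !(mul_letters0 x) !LD.
by rewrite (AC (3*3*3) ((1*4*7)*2*5*3*6*8*9)).
Qed.

Let mul_letters3l x y z f g h :
  L x f ** L y g ** L z h =
    L x (f ** L y g ** L z h) + L y (L x f ** g ** L z h)
    + L z (L x f ** L y g ** h) + L (br x y) (f ** g ** L z h)
    + L (br x z) (f ** L y g ** h) + L (br y z) (L x f ** g ** h)
    + L (br (br x y) z) (f ** g ** h).
Proof.
(* Here it is the term headed by [z] that arises in three pieces, 2, 5 and 8. *)
rewrite [in LHS](mul_letters0 x y) [in X in _ = _ + _ + X + _ + _ + _ + _](mul_letters0 x y).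
rewrite !mulDl !(mul_letters0 _ z) !LD.
by rewrite (AC (3*3*3) (1*4*(2*5*8)*7*3*6*9)).
Qed.

Let mul_WA u v w : W u ** (W v ** W w) = W u ** W v ** W w.
Proof.
elim: u v w => [|a u IHu] v w; first by rewrite !qsrec1l.
elim: v w => [|b v IHv] w; first by rewrite qsrec1l qsrec1r.
elim: w => [|c w IHw]; first by rewrite !qsrec1r.
(* One induction hypothesis for each nonempty set of first letters removed, matching the seven terms
   of the two expansions. *)
move: (IHu (b :: v) (c :: w)) (IHv (c :: w)) IHw (IHu v (c :: w))
  (IHu (b :: v) w) (IHv w) (IHu v w).
rewrite -!L_Some => Ex Ey Ez Exy Exz Eyz Exyz.
by rewrite mul_letters3r mul_letters3l Ex Ey Ez Exy Exz Eyz Exyz brA.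
Qed.

Lemma qsrecA : associative mul.
Proof.
move=> f g h; elim/W_ind: f => [|c u f IHf]; first by rewrite !mul0l.
rewrite !mul_linearl IHf; congr (_ *: _ + _) => {c f IHf}.
elim/W_ind: g => [|c v g IHg]; first by rewrite !(mul0l, mul0r).
rewrite !(mul_linearl, mul_linearr) IHg; congr (_ *: _ + _) => {c g IHg}.
elim/W_ind: h => [|c w h IHh]; first by rewrite !mul0r.
by rewrite !mul_linearr IHh mul_WA.
Qed.

(** Exchanging the factors swaps the first two terms of the recursion and preserves the third, by
    symmetry of the bracket. *)
Let mul_WC u v : W u ** W v = W v ** W u.
Proof.
elim: u v => [|a u IHu] v; first by rewrite mul_W1l mul_W1r.
elim: v => [|b v IHv]; first by rewrite mul_W1l mul_W1r.
rewrite !mul_Wcons (IHu (b :: v)) IHv (IHu v) brC.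
by rewrite (addrC (L (Some a) _)).
Qed.

Lemma qsrecC : commutative mul.
Proof.
move=> f g; elim/W_ind: f => [|c u f IHf]; first by rewrite mul0l mul0r.
rewrite mul_linearl mul_linearr IHf; congr (_ *: _ + _) => {c f IHf}.
elim/W_ind: g => [|c v g IHg]; first by rewrite mul0l mul0r.
by rewrite mul_linearl mul_linearr IHg mul_WC.
Qed.

End QuasiShuffleRecursion.

(** * The quasi-shuffle product as an instance of the recursion *)

Section QuasiShuffleAlgebra.
Variables (k : fieldType) (A : choiceType) (deg : A -> nat).
Variables (br : option A -> option A -> option A).
Hypothesis hbr : bracket_axioms deg br.

Implicit Types (f g h : ncpoly k A) (u v w : seq A).

Local Notation "f ** g" := (qsh br f g) (at level 40, left associativity).

Lemma qsh_word0 u : qsh_word k br u [::] = word k u.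
Proof. by case: u. Qed.

(** Nesting the two linear extensions in either order gives linearity in either argument. *)
Lemma qsh_lextl f g :
  f ** g = lext (fun u : {fmonom A} => lext (fun v : {fmonom A} => qsh_word k br u v) g) f.
Proof.
apply: eq_bigr => u _; rewrite scaler_sumr.
by apply: eq_bigr => v _; rewrite scalerA.
Qed.

Lemma qsh_lextr f g :
  f ** g = lext (fun v : {fmonom A} => lext (fun u : {fmonom A} => qsh_word k br u v) f) g.
Proof.
rewrite /qsh exchange_big; apply: eq_bigr => v _; rewrite scaler_sumr.
by apply: eq_bigr => u _; rewrite scalerA mulrC.
Qed.

Lemma qsh_linearl g : linear (fun f => f ** g).
Proof. by move=> c f f'; rewrite !qsh_lextl lext_linear. Qed.

Lemma qsh_linearr f : linear (qsh br f).
Proof. by move=> c g g'; rewrite !qsh_lextr lext_linear. Qed.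

Lemma qsh_wordE u v : word k u ** word k v = qsh_word k br u v.
Proof. by rewrite qsh_lextl /word !lextU. Qed.

Lemma qsh_word1l u : word k [::] ** word k u = word k u.
Proof. exact: qsh_wordE. Qed.

Lemma qsh_word1r u : word k u ** word k [::] = word k u.
Proof. by rewrite qsh_wordE qsh_word0. Qed.

Lemma qsh1l f : word k [::] ** f = f.
Proof. exact: (qsrec1l (@ncpoly_ind k A) qsh_linearr qsh_word1l). Qed.

Lemma qsh1r f : f ** word k [::] = f.
Proof. exact: (qsrec1r (@ncpoly_ind k A) qsh_linearl qsh_word1r). Qed.

Lemma letter0_mul_linear x : linear (fun f => letter0 k x * f).
Proof.
case: x => [a|]; first exact: word_mul_linear.
by move=> c f g; rewrite !mul0r scaler0 addr0.
Qed.

Lemma qsh_word_cons a u b v :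
  word k (a :: u) ** word k (b :: v) =
    letter0 k (Some a) * (word k u ** word k (b :: v))
    + letter0 k (Some b) * (word k (a :: u) ** word k v)
    + letter0 k (br (Some a) (Some b)) * (word k u ** word k v).
Proof. by rewrite !qsh_wordE. Qed.

Lemma qshA : associative (qsh (k := k) br).
Proof.
exact: (qsrecA (br_S0 hbr) (br_S1 hbr) (br_S2 hbr) (@ncpoly_ind k A)
  letter0_mul_linear (@mul0r _) (fun a => word_mul k [:: a])
  qsh_linearl qsh_linearr qsh_word1l qsh_word1r qsh_word_cons).
Qed.

Lemma qshC : commutative (qsh (k := k) br).
Proof.
exact: (qsrecC (L := fun x f => letter0 k x * f) (br_S1 hbr)
  (@ncpoly_ind k A)
  qsh_linearl qsh_linearr qsh_word1l qsh_word1r qsh_word_cons).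
Qed.

(** * The grading by degree *)

Local Notation homog n := (ncpoly_homog (k := k) deg n).

Lemma homogP n f :
  reflect (forall w : {fmonom A}, f@_w != 0 -> word_deg deg w = n)
          (f \in homog n).
Proof.
apply: (iffP allP) => H w; first by rewrite mcoeff_neq0 => /H /eqP.
by rewrite -mcoeff_neq0 => /H /eqP.
Qed.

Lemma homog_submod_closed n : GRing.submod_closed (homog n).
Proof.
split=> [|c f g /homogP Hf /homogP Hg]; apply/homogP => w.
  by rewrite mcoeff0 eqxx.
rewrite mcoeffD mcoeffZ; have [->|/Hf //] := eqVneq f@_w 0.
by rewrite mulr0 add0r; apply: Hg.
Qed.

Lemma homog0 n : 0 \in homog n.
Proof. by case: (homog_submod_closed n). Qed.

Lemma homogD n f g : f \in homog n -> g \in homog n -> f + g \in homog n.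
Proof.
move=> Hf Hg; have [_ /(_ 1 f g Hf Hg)] := homog_submod_closed n.
by rewrite scale1r.
Qed.

Lemma homogZ n c f : f \in homog n -> c *: f \in homog n.
Proof.
move=> Hf; have [H0 /(_ c f 0 Hf H0)] := homog_submod_closed n.
by rewrite addr0.
Qed.

Lemma homog_sum n (I : eqType) (r : seq I) (F : I -> ncpoly k A) :
  (forall i, i \in r -> F i \in homog n) -> \sum_(i <- r) F i \in homog n.
Proof.
move=> HF; rewrite big_seq; elim/big_ind: _ => //; first exact: homog0.
exact: homogD.
Qed.

Lemma homog_word w : word k w \in homog (word_deg deg w).
Proof.
apply/homogP => v; rewrite mcoeffU; have [<- //|_] := eqVneq (FMonom w) v.
by rewrite mulr0n eqxx.
Qed.

Lemma homog_mul m n f g :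
  f \in homog m -> g \in homog n -> f * g \in homog (m + n).
Proof.
move=> /allP Hf /allP Hg; apply/allP => w.
move=> /msuppM_le [u [v [/Hf /eqP <- /Hg /eqP <- ->]]] /=.
by rewrite /word_deg fmM big_cat.
Qed.

Lemma homog_qsh_word u v :
  qsh_word k br u v \in homog (word_deg deg u + word_deg deg v).
Proof.
have degC a w : word_deg deg (a :: w) = (deg a + word_deg deg w)%N.
  by rewrite /word_deg big_cons.
have deg1 a : word_deg deg [:: a] = deg a by rewrite /word_deg big_seq1.
elim: u v => [|a u IHu] v.
  by rewrite {1}/word_deg big_nil; apply: homog_word.
elim: v => [|b v IHv].
  by rewrite [X in (_ + X)%N]/word_deg big_nil addn0; apply: homog_word.
rewrite /=; apply: homogD; first apply: homogD.
- rewrite degC -addnA -(deg1 a).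
  by apply: homog_mul; [apply: homog_word | apply: IHu].
- rewrite (degC b) addnCA -(deg1 b).
  by apply: homog_mul; [apply: homog_word | apply: IHv].
(* By (S3) the bracket is either 0, which is homogeneous of every degree, or a letter of degree
   [deg a + deg b]. *)
rewrite !degC addnACA; case: (br_S3 hbr a b) => [-> | [c -> <-]].
  by rewrite mul0r homog0.
by rewrite -(deg1 c); apply: homog_mul; [apply: homog_word | apply: IHu].
Qed.

Lemma homog_qsh m n f g :
  f \in homog m -> g \in homog n -> f ** g \in homog (m + n).
Proof.
move=> /allP Hf /allP Hg; apply: homog_sum => u /Hf /eqP <-.
apply: homog_sum => v /Hg /eqP <-.
exact/homogZ/homog_qsh_word.
Qed.

Definition homog_comp n f : ncpoly k A :=
  \sum_(w <- msupp f | word_deg deg w == n) << f@_w *g w >>.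

Lemma mcoeff_homog_comp n f (w : {fmonom A}) :
  (homog_comp n f)@_w = f@_w *+ (word_deg deg w == n).
Proof.
rewrite /homog_comp big_mkcond raddf_sum /=.
rewrite [in RHS](monalgE f) raddf_sum -sumrMnl; apply: eq_bigr => v _ /=.
case: (eqVneq v w) => [->|nvw]; first by case: eqP; rewrite ?mcoeff0.
by rewrite (fun_if (mcoeff w)) mcoeff0 mcoeffU (negPf nvw) if_same mul0rn.
Qed.

Lemma homog_comp_homog n f : homog_comp n f \in homog n.
Proof.
apply/homogP => w; rewrite mcoeff_homog_comp.
by case: (word_deg deg w =P n) => //; rewrite mulr0n eqxx.
Qed.

(** A homogeneous family is recovered from its sum by projection. This gives uniqueness of the
    decomposition and also serves for existence. *)
Lemma homog_sumE (c : {fsfun nat -> ncpoly k A with 0}) n :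
  (forall i, c i \in homog i) ->
  c n = homog_comp n (\sum_(i <- finsupp c) c i).
Proof.
move=> Hc; apply/malgP => w; rewrite mcoeff_homog_comp raddf_sum /=.
have cE i : i != word_deg deg w -> (c i)@_w = 0.
  by move=> ne; apply/eqP; apply: contraNT ne => /(homogP _ _ (Hc i)) ->.
(* Only the component of degree [word_deg deg w] can contain [w]; if that degree is outside the
   support of [c], both sides are 0. *)
have -> : \sum_(i <- finsupp c) (c i)@_w = (c (word_deg deg w))@_w.
  have [wc|wNc] := boolP (word_deg deg w \in finsupp c).
    by rewrite (big_fsetD1 _ wc) /= big1_fset ?addr0 // => i;
       rewrite !inE => /andP [/cE].
  rewrite (fsfun_dflt wNc) mcoeff0 big_seq big1 // => i ic; apply: cE.
  by apply: contraNneq wNc => <-.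
by have [->|/[1!eq_sym] /cE ->] := eqVneq (word_deg deg w) n.
Qed.

Lemma homog_direct_sum f : exists! c : {fsfun nat -> ncpoly k A with 0},
  (forall n, c n \in homog n) /\ f = \sum_(n <- finsupp c) c n.
Proof.
pose d := [fset word_deg deg w | w : {fmonom A} in msupp f]%fset.
pose c : {fsfun nat -> ncpoly k A with 0} := [fsfun n in d => homog_comp n f].
(* Outside [d] the default value 0 is correct, because no word of [f] has such a degree. *)
have cE n : c n = homog_comp n f.
  rewrite fsfun_fun; case: ifP => // /negP nd; apply/esym/malgP => w.
  rewrite mcoeff_homog_comp mcoeff0; case: eqP => // wn.
  apply/eqP; rewrite mulr1n mcoeff_eq0; apply/negP => wf; apply: nd.
  by rewrite -wn; apply: in_imfset.
exists c; split=> [|c' [Hc' fE]]; last first.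
  by apply/fsfunP => n; rewrite cE (homog_sumE n Hc') -fE.
split=> [n|]; first by rewrite cE homog_comp_homog.
have c_homog n : c n \in homog n by rewrite cE homog_comp_homog.
(* The coefficient of [w] is compared in the component of its own degree, where projection preserves
   it. *)
apply/malgP => w; have := congr1 (mcoeff w) (homog_sumE (word_deg deg w) c_homog).
by rewrite cE !mcoeff_homog_comp eqxx.
Qed.

End QuasiShuffleAlgebra.

Theorem theorem2p1 (R : realType) (S : pred (complex R)) (k : subFieldType S)
    (A : choiceType) (deg : A -> nat)
    (br : option A -> option A -> option A)
    (hdeg : locally_finite_grading deg) (hbr : bracket_axioms deg br) :
  comm_graded_algebra (V := ncpoly k A)
    (qsh br) (word k [::]) (ncpoly_homog deg).
Proof.
split.
- by split=> [g | f]; [apply: qsh_linearl | apply: qsh_linearr].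
- exact: qshA hbr.
- exact: qshC hbr.
- by split=> f; [apply: qsh1l | apply: qsh1r].
- exact: homog_submod_closed.
- exact: homog_direct_sum.
- by have := homog_word k deg [::]; rewrite /word_deg big_nil.
- exact: homog_qsh hbr.
Qed.
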